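(* Let $n$ be a positive integer and assume that each eigenvalue of the matrix $B\in M_n(\mathbb{C})$ has algebraic multiplicity at most $\frac{n}{2}$. Then every trace zero matrix $A\in M_n(\mathbb{C})$ can be written as $$A=B'-B''+B'''-B'''',$$ where each of $B',B'',B''',B''''$ is a matrix in $M_n(\mathbb{C})$ similar to $B$. *)

(* Defs.v *)
From mathcomp Require Export all_boot all_algebra.
From mathcomp Require Export mxred reals.
From mathcomp Require Export complex.
Export GRing.Theory Num.Theory.

#[export] Set Implicit Arguments.
#[export] Unset Strict Implicit.
#[export] Unset Printing Implicit Defensive.

Definition alg_mult (F : fieldType) (n : nat) (B : 'M[F]_n) (x : F) : nat :=
  mup x (char_poly B).

Definition mx_similar (F : fieldType) (n : nat) (A B : 'M[F]_n) : Prop :=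
  similar_in (@unitmx F n) A B.

(* Main.v *)
(* It suffices to find B1, B2 similar to B such that C = B1 - B2 has a simple
   spectrum t: a trace zero matrix A is similar to a matrix with zero diagonal,
   hence to L + U with L lower triangular, U upper triangular and diagonals t and
   - t, and then L and - U, having the same simple spectrum as C, are similar to C.
   For C, the multiplicity bound lets one group the eigenvalues of B into pairs of
   distinct values (with one left over if n is odd), so that B is similar to a block
   triangular matrix with diagonal blocks diag(a, b), a != b. Such a block minus a
   suitable conjugate of it has any prescribed eigenvalues c, - c, and the values c
   can be chosen distinct in different blocks. *)
Require Import Defs.
From mathcomp Require Import all_boot all_algebra mxred reals complex.
From mathcomp Require Import order zify ring.
Import GRing.Theory Num.Theory.
Import Order.TTheory.
Local Open Scope ring_scope.
Local Open Scope complex_scope.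

(** * Similarity and characteristic polynomials of block matrices *)

Lemma det_block22 (R : comNzRingType) (a b c d : R) :
  \det (block_mx a%:M b%:M c%:M d%:M : 'M_(1 + 1)) = a * d - b * c.
Proof.
have E1 : lift (lshift 1 (ord0 : 'I_1)) ord0 = rshift 1 ord0 by apply/val_inj.
have E2 : lift (rshift 1 (ord0 : 'I_1)) ord0 = lshift 1 ord0 by apply/val_inj.
rewrite (expand_det_row _ (lshift 1 ord0)) big_split_ord /= !big_ord1 /cofactor !det_mx11.
rewrite block_mxEul block_mxEur 3!mxE E1 block_mxEdr 4!mxE E1 E2 block_mxEdl !mxE /=.
ring.
Qed.

Section Similarity.
Variable F : fieldType.

Lemma mx_similarP n (A B : 'M[F]_n) :
  mx_similar A B <-> exists2 P, P \in unitmx & P *m A = B *m P.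
Proof.
by split=> -[P Pu] /(similarP Pu); exists P.
Qed.

Lemma mx_similar_refl n (A : 'M[F]_n) : mx_similar A A.
Proof. by apply/mx_similarP; exists 1%:M; rewrite ?unitmx1 // mul1mx mulmx1. Qed.

Lemma mx_similar_sym n (A B : 'M[F]_n) : mx_similar A B -> mx_similar B A.
Proof.
move=> /mx_similarP[P Pu PA]; apply/mx_similarP.
exists (invmx P); rewrite ?unitmx_inv //.
by rewrite -[LHS](mulmxK Pu) -(mulmxA _ B) -PA mulKmx.
Qed.

Lemma mx_similar_trans n (A B C : 'M[F]_n) :
  mx_similar A B -> mx_similar B C -> mx_similar A C.
Proof.
move=> /mx_similarP[P Pu PA] /mx_similarP[Q Qu QB]; apply/mx_similarP.
by exists (Q *m P); rewrite ?unitmx_mul ?Pu ?Qu // -mulmxA PA !mulmxA QB.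
Qed.

Lemma mx_similarN n (A B : 'M[F]_n) : mx_similar A B -> mx_similar (- A) (- B).
Proof.
move=> /mx_similarP[P Pu PA]; apply/mx_similarP; exists P => //.
by rewrite mulmxN mulNmx PA.
Qed.

Lemma mx_similarD n (A X Y : 'M[F]_n) : mx_similar A (X + Y) ->
  exists X' Y', [/\ A = X' + Y', mx_similar X' X & mx_similar Y' Y].
Proof.
move=> /mx_similarP[P Pu PA].
exists (invmx P *m X *m P), (invmx P *m Y *m P); split.
- by rewrite -mulmxDl -mulmxDr -mulmxA -PA mulKmx.
- by apply/mx_similarP; exists P; rewrite // -!mulmxA mulKVmx.
- by apply/mx_similarP; exists P; rewrite // -!mulmxA mulKVmx.
Qed.

Lemma char_poly_similar n (A B : 'M[F]_n) :
  mx_similar A B -> char_poly A = char_poly B.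
Proof.
move=> /mx_similarP[P Pu PA]; rewrite /char_poly /char_poly_mx.
pose Q : 'M[{poly F}]_n := map_mx polyC P.
have detQ : \det Q != 0.
  by rewrite /Q det_map_mx polyC_eq0 -unitfE; move: Pu; rewrite unitmxE.
apply: (mulfI detQ); rewrite -det_mulmx [RHS]mulrC -det_mulmx.
by rewrite mulmxBr mulmxBl scalar_mxC /Q -!map_mxM PA.
Qed.

Lemma mxtrace_similar n (A B : 'M[F]_n) : mx_similar A B -> \tr A = \tr B.
Proof.
move=> /mx_similarP[P Pu PA].
by rewrite -(mulmxK Pu B) -PA mxtrace_mulC mulKmx.
Qed.

(** Conjugation by diag([P], [Q]) does this. The off-diagonal blocks stay existential: later
    arguments need only the diagonal blocks and a zero upper right block that survives. *)
Lemma block_similar m n (A A' : 'M[F]_m) (D D' : 'M[F]_n) Y X :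
    mx_similar A A' -> mx_similar D D' ->
  exists Y' X', mx_similar (block_mx A Y X D) (block_mx A' Y' X' D')
                /\ (Y = 0 -> Y' = 0).
Proof.
move=> /mx_similarP[P Pu PA] /mx_similarP[Q Qu QD].
exists (P *m Y *m invmx Q), (Q *m X *m invmx P); split; last first.
  by move=> ->; rewrite mulmx0 mul0mx.
apply/mx_similarP; exists (block_mx P 0 0 Q).
  by rewrite unitmxE det_lblock unitrM -!unitmxE Pu.
rewrite !mulmx_block !mul0mx !mulmx0 !addr0 !add0r PA QD.
by rewrite !mulmxKV.
Qed.

Lemma char_poly_lblock m n (A : 'M[F]_m) X (D : 'M[F]_n) :
  char_poly (block_mx A 0 X D) = char_poly A * char_poly D.
Proof.
rewrite /char_poly /char_poly_mx map_block_mx scalar_mx_block opp_block_mx.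
by rewrite add_block_mx map_mx0 subr0 det_lblock.
Qed.

Lemma char_poly_trmx n (A : 'M[F]_n) : char_poly A^T = char_poly A.
Proof.
by rewrite /char_poly /char_poly_mx -map_trmx -[in LHS]tr_scalar_mx -linearB det_tr.
Qed.

Lemma char_poly_mx11 (a : F) : char_poly (a%:M : 'M_1) = 'X - a%:P.
Proof. by rewrite /char_poly /char_poly_mx det_mx11 !mxE. Qed.

Lemma char_poly_block22 (a b c d : F) :
  char_poly (block_mx a%:M b%:M c%:M d%:M : 'M_(1 + 1)) =
    'X^2 - (a + d)%:P * 'X + (a * d - b * c)%:P.
Proof.
rewrite /char_poly /char_poly_mx map_block_mx scalar_mx_block opp_block_mx.
rewrite add_block_mx !map_scalar_mx !add0r -!raddfB -!raddfN det_block22 /=.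
by rewrite !polyCB !polyCD !polyCM; ring.
Qed.

(** * Splitting off eigenvalues *)

Lemma row_free_completion m n (V : 'M[F]_(m, m + n)) : row_free V ->
  exists W : 'M_(n, m + n), col_mx V W \in unitmx.
Proof.
move=> Vf; have rk : \rank (V^C)%MS = n.
  by rewrite mxrank_compl (eqP Vf) addKn.
have: row_full (V + row_base V^C)%MS.
  rewrite /row_full (adds_eqmx (eqmx_refl V) (eq_row_base _)).
  exact: addsmx_compl_full.
move: (row_base _); rewrite rk => W; exists W.
by rewrite -row_full_unit /row_full -addsmxE.
Qed.

(** The rows of [V] span a space stable under [B]; in a basis starting with them, the first block
    row becomes ([B1], 0). *)
Lemma similar_lblock m n (V : 'M[F]_(m, m + n)) (B1 : 'M_m) (B : 'M_(m + n)) :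
    row_free V -> V *m B = B1 *m V ->
  exists X B2, mx_similar B (block_mx B1 0 X B2).
Proof.
move=> /row_free_completion[W Pu] VB; set P := col_mx V W in Pu.
pose Z := W *m B *m invmx P.
exists (lsubmx Z), (rsubmx Z); apply/mx_similarP; exists P => //.
rewrite /block_mx mul_col_mx hsubmxK mul_col_mx mul_row_col mul0mx addr0 VB.
by rewrite mulmxKV.
Qed.

Lemma split_eigenvalue n (B : 'M[F]_(1 + n)) a (p : {poly F}) :
    char_poly B = ('X - a%:P) * p ->
  exists X B2, mx_similar B (block_mx a%:M 0 X B2) /\ char_poly B2 = p.
Proof.
move=> cB; have /eigenvalueP[v va vN0]: eigenvalue B a.
  by rewrite eigenvalue_root_char cB rootM root_XsubC eqxx.
have vf : row_free v by rewrite /row_free rank_rV vN0.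
have [|X [B2 sB]] := similar_lblock (B1 := a%:M) vf (B := B).
  by rewrite va mul_scalar_mx.
exists X, B2; split=> //; move: cB.
rewrite (char_poly_similar sB) char_poly_lblock char_poly_mx11.
exact: (mulfI (negbT (polyXsubC_eq0 a))).
Qed.

(** Row eigenvectors for the distinct eigenvalues [a] and [b] are independent, so they can start a
    basis. *)
Lemma split_eigenvalue_pair n (B : 'M[F]_(2 + n)) a b (p : {poly F}) :
    a != b -> char_poly B = ('X - a%:P) * (('X - b%:P) * p) ->
  exists B1 X B2, [/\ mx_similar B (block_mx B1 0 X B2),
    char_poly B2 = p & B1 = block_mx a%:M 0 0 b%:M :> 'M_(1 + 1)].
Proof.
move=> ab cB; have /eigenvalueP[v va vN0]: eigenvalue B a.
  by rewrite eigenvalue_root_char cB rootM root_XsubC eqxx.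
have /eigenvalueP[w wb wN0]: eigenvalue B b.
  by rewrite eigenvalue_root_char cB !rootM !root_XsubC eqxx orbT.
pose B1 : 'M_(1 + 1) := block_mx a%:M 0 0 b%:M.
pose V : 'M_(1 + 1, 2 + n) := col_mx v w.
have VB : V *m B = B1 *m V.
  by rewrite mul_col_mx mul_block_col !mul0mx addr0 add0r !mul_scalar_mx va wb.
have Vf : row_free V.
  apply: inj_row_free => u; rewrite -[u]hsubmxK mul_row_col.
  rewrite [lsubmx u]mx11_scalar [rsubmx u]mx11_scalar !mul_scalar_mx.
  move: (lsubmx u 0 0) (rsubmx u 0 0) => x y uV0.
  (* Applying [B] to [x *: v + y *: w = 0] and eliminating [x *: v] leaves [(b - a) * y] as a
     coefficient killing [w]. *)
  have := congr1 (mulmx^~ B) uV0.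
  rewrite /= mul0mx mulmxDl -!scalemxAl va wb => uVB0.
  have xv : x *: v = - (y *: w) by apply/eqP; rewrite -addr_eq0 uV0.
  move: uVB0; rewrite scalerA mulrC -scalerA xv scalerN scalerA scalerA.
  rewrite -scaleNr -scalerDl [y * b]mulrC -mulNr -mulrDl => /eqP.
  rewrite scaler_eq0 (negPf wN0) orbF mulf_eq0 addrC subr_eq0 eq_sym (negPf ab) /=.
  move=> /eqP y0; move: xv; rewrite y0 scale0r oppr0 => /eqP.
  by rewrite scaler_eq0 (negPf vN0) orbF => /eqP->; rewrite raddf0 row_mx0.
have [X [B2 sB]] := similar_lblock Vf VB.
exists B1, X, B2; split=> //; move: cB.
rewrite (char_poly_similar sB) !char_poly_lblock !char_poly_mx11 -mulrA.
by move=> /(mulfI (negbT (polyXsubC_eq0 a)))/(mulfI (negbT (polyXsubC_eq0 b))).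
Qed.

(** As [a] is not an eigenvalue of the complementary block, a unipotent conjugation clears the lower
    left block. *)
Lemma split_simple_eigenvalue n (B : 'M[F]_(1 + n)) a (p : {poly F}) :
    char_poly B = ('X - a%:P) * p -> ~~ root p a ->
  exists B2, mx_similar B (block_mx a%:M 0 0 B2) /\ char_poly B2 = p.
Proof.
move=> /split_eigenvalue[X [B2 [sB cB2]]] pa; exists B2; split=> //.
apply: mx_similar_trans sB _; apply/mx_similarP.
have U : B2 - a%:M \in unitmx.
  rewrite -row_free_unit; apply: inj_row_free => v.
  rewrite mulmxBr mul_mx_scalar => /eqP; rewrite subr_eq0 => /eqP vB.
  apply: contraNeq pa => vN0; rewrite -cB2 -eigenvalue_root_char.
  by apply/eigenvalueP; exists v.
(* The conjugation clears [X] exactly when [B2 *m Y - a *: Y = X]. *)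
pose Y := invmx (B2 - a%:M) *m X.
exists (block_mx 1%:M 0 Y 1%:M).
  by rewrite unitmxE det_lblock !det1 mulr1 unitr1.
rewrite !mulmx_block !mul0mx !mulmx0 !mul1mx !mulmx1 !addr0 !add0r.
congr block_mx; rewrite -[X in _ + X](mulKVmx U) -/Y mulmxBl.
by rewrite mul_mx_scalar mul_scalar_mx addrC subrK.
Qed.

(** Each value in [t] is a simple root, so both matrices shed the same diagonal entries one by one,
    down to the empty matrix. *)
Lemma similar_of_simple_spectrum n (t : seq F) (A B : 'M[F]_n) : uniq t ->
    char_poly A = \prod_(x <- t) ('X - x%:P) ->
    char_poly B = \prod_(x <- t) ('X - x%:P) ->
  mx_similar A B.
Proof.
elim: t n A B => [|a t IHt] n A B /=.
  move=> _ cA _; have := size_char_poly A.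
  rewrite cA big_nil size_poly1 => -[n0].
  move: A B {cA}; rewrite -n0 => A B.
  by rewrite [A]flatmx0 [B]flatmx0; exact: mx_similar_refl.
move=> /andP[a_t ut]; case: n A B => [|n] A B cA.
  by have := size_char_poly A; rewrite cA size_prod_XsubC.
rewrite big_cons => cB; move: cA; rewrite big_cons => cA.
have pa : ~~ root (\prod_(x <- t) ('X - x%:P)) a by rewrite root_prod_XsubC.
have [A2 [sA cA2]] := split_simple_eigenvalue cA pa.
have [B2 [sB cB2]] := split_simple_eigenvalue cB pa.
apply: mx_similar_trans sA _; apply: mx_similar_trans (mx_similar_sym sB).
have /mx_similarP[P Pu PA2] := IHt _ _ _ ut cA2 cB2.
apply/mx_similarP; exists (block_mx 1%:M 0 0 P).
  by rewrite unitmxE det_lblock det1 mul1r -unitmxE.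
by rewrite !mulmx_block !mul0mx !mulmx0 !mul1mx !mulmx1 !addr0 !add0r PA2.
Qed.

(* The difference diag(a, b) - C is sought in the form [[p, 1], [r, - p]]: its
   determinant - v forces r = v - p ^+ 2, and det C = a * b forces the value of p. *)
Lemma diag2_difference (a b v : F) : a != b ->
  exists2 C : 'M_(1 + 1), mx_similar C (block_mx a%:M 0 0 b%:M)
    & char_poly (block_mx a%:M 0 0 b%:M - C) = 'X^2 - v%:P.
Proof.
move=> ab; have ab0 : a - b != 0 by rewrite subr_eq0.
pose p := v / (a - b); pose r := v - p ^+ 2.
have -> : block_mx a%:M 0 0 b%:M = block_mx a%:M 0%:M 0%:M b%:M :> 'M_(1 + 1).
  by rewrite raddf0.
exists (block_mx (a - p)%:M (- 1)%:M (- r)%:M (b + p)%:M).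
  apply: (@similar_of_simple_spectrum _ [:: a; b]); first by rewrite /= inE ab.
    rewrite char_poly_block22 !big_cons big_nil.
    have -> : (a - p) * (b + p) - - 1 * - r = a * b by rewrite /r /p; field.
    have -> : a - p + (b + p) = a + b by ring.
    by rewrite polyCD polyCM; ring.
  rewrite char_poly_block22 !big_cons big_nil.
  have -> : a * b - 0 * 0 = a * b by ring.
  by rewrite polyCD polyCM; ring.
rewrite opp_block_mx add_block_mx -!raddfB /= char_poly_block22.
have -> : a - (a - p) + (b - (b + p)) = 0 by ring.
have -> : (a - (a - p)) * (b - (b + p)) - (0 - - 1) * (0 - - r) = - v.
  by rewrite /r; ring.
by rewrite mul0r subr0 polyCN.
Qed.

End Similarity.

(** * Trace zero matrices: zero diagonal and triangular splitting *)

Section Fillmore.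
Variable F : numFieldType.

Lemma row_free_vec_mulmx n (A : 'M[F]_n) (v : 'rV_n) :
  ~~ (v *m A <= v)%MS -> row_free (col_mx v (v *m A)).
Proof.
move=> vA; apply: inj_row_free => u; rewrite -[u]hsubmxK mul_row_col.
rewrite [lsubmx u]mx11_scalar [rsubmx u]mx11_scalar !mul_scalar_mx.
move: (lsubmx u 0 0) (rsubmx u 0 0) => x y uV0.
have y0 : y = 0.
  apply: contraNeq vA => yN0; have -> : v *m A = (- (y^-1 * x)) *: v.
    apply: (scalerI yN0); rewrite scalerA mulrN mulVKf // scaleNr.
    by apply/eqP; rewrite -addr_eq0 addrC uV0.
  exact: scalemx_sub.
move: uV0; rewrite y0 scale0r addr0 => /eqP; rewrite scaler_eq0.
case/orP=> [/eqP->|/eqP v0]; first by rewrite raddf0 row_mx0.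
by rewrite v0 mul0mx sub0mx in vA.
Qed.

(* In a basis starting with v, vA, the first row of A becomes (0, 1, 0, ...). *)
Lemma similar_corner0 n (A : 'M[F]_(1 + n)) (v : 'rV_(1 + n)) :
  ~~ (v *m A <= v)%MS -> exists2 Z, mx_similar A Z & Z 0 0 = 0.
Proof.
move=> /row_free_vec_mulmx Vf.
have le2 : (1 + 1 <= 1 + n)%N by rewrite -[leqLHS](eqP Vf) rank_leq_col.
case: n A v Vf le2 => // n A v Vf _.
have [W Pu] := @row_free_completion F (1 + 1) n _ Vf.
set P := col_mx _ _ in Pu; exists (P *m A *m invmx P).
  by apply/mx_similarP; exists P => //; rewrite mulmxKV.
have rowP0 : row (lshift n (lshift 1 0)) P = v.
  by rewrite rowKu rowKu row_id.
have rowP1 : row (lshift n (rshift 1 0)) P = v *m A.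
  by rewrite rowKu rowKd row_id.
have e01 : lshift n (lshift 1 0) != lshift n (rshift 1 0) :> 'I_((1 + 1) + n) by [].
have e0 : 0 = lshift n (lshift 1 0) :> 'I_((1 + 1) + n) by apply/val_inj.
transitivity (row (lshift n (lshift 1 0)) (P *m A *m invmx P) 0 0).
  by rewrite [RHS]mxE -e0.
rewrite !row_mul rowP0 -rowP1 rowE -mulmxA mulmxV // mulmx1 mxE.
by rewrite e0 (negPf e01) andbF.
Qed.

(** Either some basis vector or the all-ones vector (index [None]) is not an eigenvector, and
    [similar_corner0] applies; or all are. In that case the basis vectors make [A] diagonal, the
    all-ones vector makes it a scalar [c], and trace zero gives [c = 0] in characteristic zero. *)
Lemma traceless_similar_corner0 n (A : 'M[F]_(1 + n)) : \tr A = 0 ->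
  exists2 Z, mx_similar A Z & Z 0 0 = 0.
Proof.
move=> trA.
have [/existsP[i vA] | /existsPn allA] :=
    boolP [exists i : option 'I_(1 + n), let v : 'rV[F]_(1 + n) :=
      if i is Some j then delta_mx 0 j else const_mx 1 in
      ~~ (v *m A <= v)%MS].
  exact: similar_corner0 vA.
have eA i j : i != j -> A i j = 0.
  have /negbNE/sub_rVP[c /(congr1 (fun u : 'rV_(1 + n) => u 0 j))] := allA (Some i).
  by rewrite -rowE !mxE eqxx /= => -> /negPf; rewrite eq_sym => ->; rewrite mulr0.
have /negbNE/sub_rVP[c] := allA None => dA.
have dAc j : A j j = c.
  move/(congr1 (fun u : 'rV_(1 + n) => u 0 j)): dA; rewrite !mxE mulr1 => <-.
  rewrite (bigD1 j) //= mxE mul1r big1 ?addr0 // => i ij.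
  by rewrite mxE mul1r eA.
exists A; first exact: mx_similar_refl.
rewrite dAc; move: trA; rewrite /mxtrace (eq_bigr (fun=> c)) //.
rewrite sumr_const card_ord => /eqP; rewrite mulrn_eq0 => /orP[//|/eqP->//].
Qed.

(** Once the corner is zero, the lower right block again has trace zero, and conjugating that block
    alone leaves the corner unchanged. *)
Lemma traceless_similar_hollow n (A : 'M[F]_n) : \tr A = 0 ->
  exists2 Z, mx_similar A Z & forall i, Z i i = 0.
Proof.
elim: n A => [|n IHn] A trA; first by exists A => [|[]//]; exact: mx_similar_refl.
have [Z sZ Z00] := @traceless_similar_corner0 n A trA.
have ulZ : ulsubmx (Z : 'M_(1 + n)) = 0.
  apply/matrixP=> i j; rewrite !mxE !ord1.
  by rewrite (_ : lshift n 0 = 0 :> 'I_(1 + n)) ?Z00 //; apply/val_inj.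
have [D sD D0] : exists2 D, mx_similar (drsubmx (Z : 'M_(1 + n))) D
    & forall i, D i i = 0.
  apply: IHn; have := mxtrace_similar sZ.
  by rewrite trA -{1}[Z](@submxK _ 1 n 1 n) mxtrace_block ulZ mxtrace0 add0r.
have [Y [X [sX _]]] := block_similar (ursubmx (Z : 'M_(1 + n)))
  (dlsubmx (Z : 'M_(1 + n))) (mx_similar_refl (0 : 'M[F]_1)) sD.
exists (block_mx 0 Y X D).
  by apply: mx_similar_trans sZ _; rewrite -{1}[Z](@submxK _ 1 n 1 n) ulZ.
move=> i; case: (@split_ordP 1 n i) => j ->.
  rewrite -[LHS]/(block_mx (0 : 'M_1) Y X D (lshift n j) (lshift n j)).
  by rewrite block_mxEul mxE.
rewrite -[LHS]/(block_mx (0 : 'M_1) Y X D (rshift 1 j) (rshift 1 j)).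
by rewrite block_mxEdr D0.
Qed.

(** The diagonal of [L] can be chosen freely: as [Z] has zero diagonal, [Z - L] then has the
    opposite one, so [L] and [- U] share the spectrum [t]. *)
Lemma hollow_triangular_split n (Z : 'M[F]_n) (t : seq F) :
    (forall i, Z i i = 0) -> size t = n ->
  exists L U, [/\ Z = L + U, char_poly L = \prod_(x <- t) ('X - x%:P)
    & char_poly (- U) = \prod_(x <- t) ('X - x%:P)].
Proof.
move=> Z0 szt.
pose L : 'M_n := \matrix_(i, j)
  if i == j then t`_i else if (j < i)%N then Z i j else 0.
have prodt : \prod_(i < n) ('X - (t`_i)%:P) = \prod_(x <- t) ('X - x%:P).
  by rewrite (big_nth 0) szt big_mkord.
exists L, (Z - L); split; first by rewrite addrC subrK.
  rewrite char_poly_trig -?prodt.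
    by apply: eq_bigr => i _; rewrite !mxE eqxx.
  apply/is_trig_mxP => i j ij; rewrite mxE -val_eqE /= (ltn_eqF ij).
  by rewrite ltnNge (ltnW ij).
(* [char_poly_trig] concerns lower triangular matrices, hence the transposition. *)
rewrite opprB -char_poly_trmx char_poly_trig -?prodt.
  by apply: eq_bigr => i _; rewrite !mxE eqxx Z0 subr0.
apply/is_trig_mxP => i j ij; rewrite !mxE -val_eqE /= (gtn_eqF ij) ij.
by rewrite subrr.
Qed.

End Fillmore.

(** * Pairing distinct values in a sequence *)

Fixpoint paired (T : eqType) (s : seq T) : bool :=
  if s is a :: b :: s' then (a != b) && paired s' else true.

Lemma ex_argmax_seq (T : eqType) (f : T -> nat) (s : seq T) : s != [::] ->
  exists2 a, a \in s & {in s, forall x, (f x <= f a)%N}.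
Proof.
elim: s => // a [|b s] IHs _; first by exists a => [|x]; rewrite inE // => /eqP->.
have [//|c cs cmax] := IHs; have [fac|fca] := leqP (f a) (f c).
  exists c => [|x]; first by rewrite inE cs orbT.
  by rewrite inE => /predU1P[->//|/cmax].
exists a => [|x]; first by rewrite inE eqxx.
by rewrite inE => /predU1P[->//|/cmax/leq_trans]; apply; apply: ltnW.
Qed.

Lemma leq_count3_size (T : eqType) (a b c : T) (s : seq T) :
    a != b -> a != c -> b != c ->
  (count_mem a s + count_mem b s + count_mem c s <= size s)%N.
Proof.
move=> ab ac bc; elim: s => //= x s IHs.
have : ((x == a) + (x == b) + (x == c) <= 1)%N.
  have [->|_] := eqVneq x a; first by rewrite (negPf ab) (negPf ac).
  have [->|_] := eqVneq x b; first by rewrite (negPf bc).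
  by case: (x == c).
by lia.
Qed.

(* Pairing off two most frequent values preserves the bound on multiplicities. *)
Lemma perm_paired (T : eqType) (s : seq T) :
    (forall x, 2 * count_mem x s <= (size s).+1)%N ->
  exists2 s', perm_eq s s' & paired s'.
Proof.
move: {2}(size s) (leqnn (size s)) => k; elim: k s => [|k IHk] s.
  by rewrite leqn0 size_eq0 => /eqP-> _; exists [::].
move=> szk cnt; have [sz2|sz2] := leqP (size s) 1.
  by exists s => //; case: s sz2 {szk cnt} => [|a []].
have [|a as_ amax] := @ex_argmax_seq T (fun x => count_mem x s) s.
  by rewrite -size_eq0; lia.
have szC := count_predC (pred1 a) s.
(* By the multiplicity bound, [a] cannot fill a sequence of size at least 2, so a most frequent
   value among the others exists. *)
have [|b] := @ex_argmax_seq T (fun x => count_mem x s) (filter (predC1 a) s).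
  rewrite -size_eq0 size_filter; have := cnt a.
  by rewrite -szC -[count (predC1 a) s]/(count (predC (pred1 a)) s); lia.
rewrite mem_filter /= => /andP[ba bs] bmax.
have bra : b \in rem a s.
  by have := perm_mem (perm_to_rem as_) b; rewrite bs inE (negPf ba) /= => <-.
have sE : perm_eq s [:: a, b & rem b (rem a s)].
  by apply: perm_trans (perm_to_rem as_) _; rewrite perm_cons perm_to_rem.
have szE := perm_size sE; have /permP cE := sE; rewrite /= in szE.
have [||s' s's ps'] := IHk (rem b (rem a s)); first by lia.
  move=> x; have := cE (pred1 x); have := cnt x; rewrite /=.
  case: (eqVneq a x) => [_|ax]; first by lia.
  case: (eqVneq b x) => [_|bx]; first by lia.
  (* A third value [x] is at most as frequent as [a] and [b], so it fills at most a third of [s];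
     the bound survives the loss of two entries. *)
  have := @leq_count3_size _ a b x s; rewrite eq_sym ba ax bx => /(_ isT isT isT).
  have [xs|/count_memPn->] := boolP (x \in s); last by lia.
  have := amax _ xs; have := bmax x; rewrite mem_filter /= eq_sym ax xs => /(_ isT).
  by lia.
exists [:: a, b & s']; last by rewrite /= eq_sym ba.
by apply: perm_trans sE _; rewrite !perm_cons.
Qed.

(** * Differences of two conjugates with simple spectrum *)

Section Differences.
Variable F : numFieldType.

(** Induction removing two eigenvalues of [B] at a time. The norm bound on [t] is there for the
    induction: it guarantees that the next two eigenvalues are new. *)
Lemma simple_spectrum_difference n (s : seq F) (B : 'M[F]_n) : paired s ->
    char_poly B = \prod_(x <- s) ('X - x%:P) ->
  exists B1 B2, [/\ mx_similar B1 B, mx_similar B2 B &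
    exists t, [/\ uniq t, {in t, forall x, `|x| <= n%:R}
      & char_poly (B1 - B2) = \prod_(x <- t) ('X - x%:P)]].
Proof.
move: {2}(size s) (leqnn (size s)) => k; elim: k s n B => [|k IHk] s n B.
  rewrite leqn0 size_eq0 => /eqP-> _ cB; exists B, B.
  split; try exact: mx_similar_refl.
  have := size_char_poly B; rewrite cB size_prod_XsubC => -[/= n0].
  exists [::]; split=> //; rewrite -cB subrr; congr char_poly.
  by move: (B) => C; apply/matrixP => -[i ltin]; exfalso; rewrite -n0 in ltin.
move=> szk ps cB; have := size_char_poly B; rewrite cB size_prod_XsubC => -[].
case: s szk ps cB => [|a [|b s]] szk ps cB.
- by move=> _; apply: (IHk [::]).
- move=> /= n1; move: B cB; rewrite -n1 => B _.
  exists B, B; split; try exact: mx_similar_refl.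
  (* The unpaired eigenvalue contributes a zero difference; 0 never collides with the later values,
     which have positive norm. *)
  exists [:: 0]; split=> // [x|]; first by rewrite inE => /eqP->; rewrite normr0 ler01.
  by rewrite subrr big_seq1 -char_poly_mx11 raddf0.
case: n B cB => [//|[//|n]] B cB _.
move: ps => /= /andP[ab ps]; rewrite !big_cons in cB.
have [D1 [X [D2 [sB cD2 defD1]]]] := @split_eigenvalue_pair F n B _ _ _ ab cB.
have [|E1 [E2 [sE1 sE2 [t [ut tn cE]]]]] := IHk s _ D2 _ ps cD2.
  by move: szk => /=; lia.
(* The values of [t] have norm at most [n], so [c] and [- c] avoid them; they are the roots of
   ['X^2 - (c ^+ 2)%:P]. *)
pose c : F := n.+1%:R.
have [C sC cC] := diag2_difference (c ^+ 2) ab; rewrite -defD1 in sC cC.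
(* Two conjugates of the same block triangular matrix: one keeps [D1], the other replaces it by [C].
   Both have zero upper right block, so only diagonal blocks matter in the difference. *)
have [Y1 [X1 [s1 /(_ erefl) Y10]]] :=
  block_similar 0 X (mx_similar_refl D1) (mx_similar_sym sE1).
have [Y2 [X2 [s2 /(_ erefl) Y20]]] :=
  block_similar 0 X (mx_similar_sym sC) (mx_similar_sym sE2).
rewrite {}Y10 {Y1} in s1; rewrite {}Y20 {Y2} in s2.
exists (block_mx D1 0 X1 E1), (block_mx C 0 X2 E2); split.
- exact/mx_similar_sym/(mx_similar_trans sB).
- exact/mx_similar_sym/(mx_similar_trans sB).
have c_gt0 : 0 < c by rewrite ltr0n.
have c_t x : `|x| = c -> x \notin t.
  move=> xc; apply/negP => /tn; rewrite xc /c ler_nat; lia.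
exists [:: c, - c & t]; split.
- rewrite /= inE negb_or !c_t ?normrN ?gtr0_norm // ut !andbT.
  by rewrite -addr_eq0 -mulr2n mulrn_eq0 /= gt_eqF.
- move=> x; rewrite !inE => /or3P[/eqP->|/eqP->|/tn/le_trans]; last first.
  + by apply; rewrite ler_nat; lia.
  + by rewrite normrN gtr0_norm // ler_nat.
  + by rewrite gtr0_norm // ler_nat.
transitivity (char_poly (block_mx (D1 - C) 0 (X1 - X2) (E1 - E2))).
  have := add_block_mx D1 0 X1 E1 (- C) (- 0) (- X2) (- E2).
  by rewrite -opp_block_mx subrr => <-.
rewrite char_poly_lblock cC cE !big_cons.
by rewrite mulrA; congr (_ * _); rewrite polyCN rmorphXn /=; ring.
Qed.

End Differences.

(** * Assembling the four conjugates *)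

Lemma traceless_alternating_sum (F : numClosedFieldType) (n : nat) (A B : 'M[F]_n) :
    (forall x, eigenvalue B x -> (2 * alg_mult B x <= n)%N) -> \tr A = 0 ->
  exists B1 B2 B3 B4 : 'M[F]_n,
    [/\ mx_similar B1 B, mx_similar B2 B, mx_similar B3 B & mx_similar B4 B]
    /\ A = B1 - B2 + B3 - B4.
Proof.
move=> multB trA.
have [s cB] := closed_field_poly_normal (char_poly B).
rewrite (monicP (char_poly_monic B)) scale1r in cB.
have szs : size s = n.
  by have := size_char_poly B; rewrite cB size_prod_XsubC => -[].
have [|s' ss' ps'] := @perm_paired _ s.
  (* The hypothesis bounds only eigenvalues; any other value has count 0 in [s]. *)
  move=> x; rewrite szs; have [xs|/count_memPn->//] := boolP (x \in s).
  have <- : alg_mult B x = count_mem x s.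
    by rewrite /alg_mult cB mu_prod_XsubC.
  by rewrite ltnW // ltnS multB // eigenvalue_root_char cB root_prod_XsubC.
rewrite (perm_big _ ss') /= in cB.
have [C1 [C2 [sC1 sC2 [t [ut _ cC]]]]] := simple_spectrum_difference ps' cB.
have szt : size t = n.
  by have := size_char_poly (C1 - C2); rewrite cC size_prod_XsubC => -[].
have [Z sZ Z0] := traceless_similar_hollow trA.
have [L [U [defZ cL cU]]] := hollow_triangular_split Z0 szt.
rewrite {}defZ in sZ; have [L' [U' [-> sL sU]]] := mx_similarD sZ.
have {}sL := mx_similar_trans sL (similar_of_simple_spectrum ut cL cC).
have {}sU := mx_similar_trans (mx_similarN sU) (similar_of_simple_spectrum ut cU cC).
have [B1 [B2 [-> sB1 sB2]]] := mx_similarD sL.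
have [B4 [B3 [defU sB4 sB3]]] := mx_similarD sU.
(* The sums split [L'] and [- U'] as conjugates of [C1 + (- C2)], so [B2] and [B3] are similar to
   [- C2] and change sign here. *)
exists B1, (- B2), (- B3), B4; split; last first.
  by rewrite opprK -[U']opprK defU opprD addrA addrAC.
split.
- exact: mx_similar_trans sB1 sC1.
- by have := mx_similarN sB2; rewrite opprK => /mx_similar_trans; apply.
- by have := mx_similarN sB3; rewrite opprK => /mx_similar_trans; apply.
- exact: mx_similar_trans sB4 sC1.
Qed.

Theorem theorem2p9 (R : realType) (n : nat) (n_gt0 : (0 < n)%N)
    (B : 'M[R[i]]_n)
    (multB : forall x : R[i], eigenvalue B x -> (2 * alg_mult B x <= n)%N)
    (A : 'M[R[i]]_n) (trA : \tr A = 0) :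
  exists B1 B2 B3 B4 : 'M[R[i]]_n,
    [/\ mx_similar B1 B, mx_similar B2 B, mx_similar B3 B & mx_similar B4 B]
    /\ A = B1 - B2 + B3 - B4.
Proof.
exact: traceless_alternating_sum multB trA.
Qed.
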